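(* There exists a constant $\alpha\in(0,1)$ such that, for every $p\in\mathcal T$: if $\mathbb P_p(E_n)<\alpha$ for some integer $n>1$, then $\mathbb P_p(E_n)$ tends to zero exponentially fast as a function of $n$ (i.e. there are $C,c>0$ with $\mathbb P_p(E_n)\le Ce^{-cn}$ for all $n\ge1$). Hence every $p\in\mathcal T$ belongs to either the compact phase or the extended phase.
   Context: Let $\mathcal L=2\mathbb Z^3\cup(2\mathbb Z^3+(1,1,1))$ and consider its Voronoi tessellation of $\mathbb R^3$ (by truncated octahedra). Cells are indexed by their centers $v\in\mathcal L$; cells $v,w$ are adjacent (share a face) iff $v-w\in\{(\pm2,0,0),(0,\pm2,0),(0,0,\pm2)\}$ or $v-w\in\{(\pm1,\pm1,\pm1)\}$. Faces, edges and vertices of the tessellation correspond bijectively to sets of $2$, $3$ and $4$ mutually adjacent cells respectively; incidence corresponds to inclusion. Let $\mathcal T=\{p\in[0,1]^3:p_1+p_2+p_3=1\}$. For $p\in\mathcal T$, $\mathbb P_p$ is the law of the random coloring in which each cell independently gets color $i\in\{1,2,3\}$ (red, yellow, blue) with probability $p_i$. A tricolor edge is an edge of the tessellation whose three incident cells have three different colors; a tricolor vertex is a vertex incident to cells of all three colors. Each tricolor vertex is incident to exactly two tricolor edges and each tricolor edge to two tricolor vertices, so tricolor edges form disjoint loops and/or infinite paths. A tricolor path is a path (along the edges of the tessellation) of tricolor edges. For $n\ge1$ an integer, let $A_n=([-3n,3n]^3\setminus[-n,n]^3)\cap\mathcal L$. $E_n$ is the event that there is a tricolor path from a vertex on the interior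 boundary of $A_n$ (a vertex of the tessellation incident both to a cell in $A_n$ and to a cell in $\mathcal L\cap[-n,n]^3$) to a vertex on the exterior boundary of $A_n$ (a vertex incident both to a cell in $A_n$ and to a cell in $\mathcal L\setminus[-3n,3n]^3$). A vector $p\in\mathcal T$ lies in the compact phase if $\mathbb P_p(E_n)$ tends to zero exponentially fast in $n$; it lies in the extended phase if $\mathbb P_p(E_n)$ is bounded below by a positive constant independent of $n$. *)

(* Defs.v *)
From HB Require Import structures.
From mathcomp Require Import all_boot all_order all_algebra finmap.
From mathcomp Require Import all_classical all_reals all_analysis.
From mathcomp Require Import measurable_realfun lra.

Set Implicit Arguments.
Unset Strict Implicit.
Unset Printing Implicit Defensive.

Import Order.TTheory GRing.Theory Num.Theory.

Local Open Scope classical_set_scope.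
Local Open Scope ring_scope.

Definition in_lattice (v : 'rV[int]_3) : bool :=
  [forall i, (2 %| v ord0 i)%Z] || [forall i, (2 %| (v ord0 i - 1)%R)%Z].

(* A cell of the tessellation is represented by its center. *)
Definition cell : Type := {v : 'rV[int]_3 | in_lattice v}.
HB.instance Definition _ := Countable.on cell.

Definition adjacent (v w : cell) : bool :=
  let d := val v - val w in
  [exists i, (d == 2 *: delta_mx 0 i) || (d == - 2 *: delta_mx 0 i)]
  || [forall i, `|d 0 i| == 1].

Definition mutually_adjacent (F : {fset cell}) : Prop :=
  {in F &, forall v w, v != w -> adjacent v w}.

(* Edges and vertices of the tessellation are represented by their sets of
   incident cells, so that incidence is inclusion. *)
Definition is_edge (e : {fset cell}) : Prop :=
  #|` e| = 3%N /\ mutually_adjacent e.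

Definition is_vertex (x : {fset cell}) : Prop :=
  #|` x| = 4%N /\ mutually_adjacent x.

(* 0 is red, 1 is yellow, 2 is blue. *)
Definition color : Type := 'I_3.
HB.instance Definition _ := Finite.on color.
HB.instance Definition _ := isPointed.Build color (ord0 : 'I_3).

Definition coloring : Type := cell -> color.
HB.instance Definition _ := Pointed.on coloring.

Definition tricolor_edge (w : coloring) (e : {fset cell}) : Prop :=
  is_edge e /\ {in e &, injective w}.

Definition tricolor_step (w : coloring) : rel {fset cell} := fun x y =>
  `[< [/\ is_vertex x, is_vertex y, x != y &
      exists e, [/\ tricolor_edge w e, (e `<=` x)%fset & (e `<=` y)%fset]] >].

Definition tricolor_path (w : coloring) (x y : {fset cell}) : Prop :=
  exists s : seq {fset cell}, path (tricolor_step w) x s /\ last x s = y.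

Definition in_box (n : nat) (v : cell) : bool :=
  [forall i, `|val v 0 i| <= n%:Z].

Definition in_annulus (n : nat) (v : cell) : bool :=
  in_box (3 * n)%N v && ~~ in_box n v.

Definition interior_boundary (n : nat) (x : {fset cell}) : Prop :=
  [/\ is_vertex x, exists2 v, v \in x & in_annulus n v &
      exists2 v, v \in x & in_box n v].

Definition exterior_boundary (n : nat) (x : {fset cell}) : Prop :=
  [/\ is_vertex x, exists2 v, v \in x & in_annulus n v &
      exists2 v, v \in x & ~~ in_box (3 * n)%N v].

Definition cylinders : set (set coloring) :=
  [set A | exists (v : cell) (i : color), A = [set w | w v = i]].

Definition coloring_space := g_sigma_algebraType cylinders.

Definition crossing (n : nat) : set coloring_space :=
  [set w | exists x y, [/\ interior_boundary n x, exterior_boundary n y &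
    tricolor_path w x y]].

Definition simplex (R : realType) : Type :=
  {p : color -> R | (forall i, 0 <= p i <= 1) /\ \sum_i p i = 1}.

(* The colors of the cells are independent, and each cell gets color i with
   probability p i. *)
Definition is_coloring_law (R : realType) (p : color -> R)
    (P : probability coloring_space R) : Prop :=
  forall (F : {fset cell}) (c : coloring),
    P [set w : coloring | forall v, v \in F -> w v = c v] = (\prod_(v <- F) p (c v))%:E.

(* Existence of the law: if x is uniform on [0, 1[, cut into three consecutive
   intervals of lengths p 0, p 1 and p 2, the first color is the index of the
   interval containing x, and the next ones are obtained by rescaling this
   interval to [0, 1[ and iterating. *)
Section existence.
Variables (R : realType) (p : color -> R).
Hypothesis p_ge0 : forall i, 0 <= p i.
Hypothesis p_sum : \sum_i p i = 1.

Local Notation mu := (@lebesgue_measure R).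

Let c0 : color := @Ordinal 3 0 isT.
Let c1 : color := @Ordinal 3 1 isT.
Let c2 : color := @Ordinal 3 2 isT.

Let sum3 (f : color -> R) : \sum_i f i = f c0 + f c1 + f c2.
Proof.
rewrite !big_ord_recl big_ord0 addr0 addrA.
by congr (f _ + f _ + f _); apply/val_inj.
Qed.

Let colorP (i : color) : [\/ i = c0, i = c1 | i = c2].
Proof.
by case: i => -[|[|[|//]]] h; [apply: Or31|apply: Or32|apply: Or33];
  apply/val_inj.
Qed.

Let digit (x : R) : color :=
  if x < p c0 then c0 else if x < p c0 + p c1 then c1 else c2.

Let off (i : color) : R :=
  if i == c0 then 0 else if i == c1 then p c0 else p c0 + p c1.

Let shift (x : R) : R := (x - off (digit x)) / p (digit x).

Let dg (k : nat) (x : R) : color := digit (iter k shift x).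

Let digitE (i : color) (x : R) : 0 <= x < 1 ->
  (digit x = i) <-> (off i <= x < off i + p i).
Proof.
have := p_sum; rewrite sum3 => ps.
have := p_ge0 c0; have := p_ge0 c1; have := p_ge0 c2 => h2 h1 h0 /andP[x0 x1].
rewrite /digit /off.
by case: (colorP i) => ->; rewrite /=; case: ltP => a; [|case: ltP => b| |case: ltP => b| |case: ltP => b];
  split => [/(congr1 val)//= _|/andP[l u]] //; try (by []); try (exfalso; lra); lra.
Qed.

Let prefix_itv (N : nat) : forall f : nat -> color, exists a : R,
  [/\ 0 <= a, a + \prod_(k < N) p (f k) <= 1 &
   forall x, (0 <= x < 1 /\ forall k, (k < N)%N -> dg k x = f k) <->
     a <= x < a + \prod_(k < N) p (f k)].
Proof.
elim: N => [|N IH] f.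
  exists 0; rewrite big_ord0 add0r; split => // x; split=> [[]//|h]; split=> //.
have [a [a0 ab H]] := IH (fun k => f k.+1).
set b := \prod_(k < N) p (f k.+1) in ab H.
have b0 : 0 <= b by apply: prodr_ge0.
exists (off (f 0%N) + p (f 0%N) * a).
have -> : \prod_(k < N.+1) p (f k) = p (f 0%N) * b by rewrite big_ord_recl.
have ps := p_sum; rewrite sum3 in ps.
have o01 : 0 <= off (f 0%N) /\ off (f 0%N) + p (f 0%N) <= 1.
  have := p_ge0 c0; have := p_ge0 c1; have := p_ge0 c2 => h2 h1 h0.
  by rewrite /off; case: (colorP (f 0%N)) => -> /=; split; lra.
case: o01 => o0 o2.
have pf := p_ge0 (f 0%N).
have pa : 0 <= p (f 0%N) * a by apply: mulr_ge0.
have pab : p (f 0%N) * (a + b) <= p (f 0%N) by rewrite ler_piMr.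
rewrite mulrDr in pab.
split; [lra|lra|] => x; split.
  move=> [x01 h].
  have d0 : digit x = f 0%N by exact: (h 0%N).
  have /andP[l u] := proj1 (digitE _ x01) d0.
  have p0 : 0 < p (f 0%N) by lra.
  have sx : shift x = (x - off (f 0%N)) / p (f 0%N) by rewrite /shift d0.
  have : a <= shift x < a + b.
    apply/H; split.
      by rewrite sx divr_ge0 ?subr_ge0//= ltr_pdivrMr// mul1r ltrBlDl.
    by move=> k kN; rewrite /dg -iterSr; apply: h.
  rewrite sx ler_pdivlMr// ltr_pdivrMr// mulrDl => /andP[? ?].
  by apply/andP; split; rewrite [_ * a]mulrC ?[_ * b]mulrC; lra.
move=> /andP[l u].
have p0 : 0 < p (f 0%N).
  by rewrite lt_neqAle pf andbT; apply/eqP => e; rewrite -e !mul0r in l u; lra.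
have x01 : 0 <= x < 1 by lra.
have d0 : digit x = f 0%N by apply/digitE => //; lra.
have sx : shift x = (x - off (f 0%N)) / p (f 0%N) by rewrite /shift d0.
have /H[_ h] : a <= shift x < a + b.
  rewrite sx ler_pdivlMr// ltr_pdivrMr// mulrDl.
  by apply/andP; split; rewrite [a * _]mulrC ?[b * _]mulrC; lra.
by split=> // -[|k] kN //; rewrite /dg iterSr; apply: h.
Qed.

Let mD : measurable (`[0, 1[%classic : set R). Proof. exact: measurable_itv. Qed.

Let unif := mrestr mu mD.
HB.instance Definition _ := Measure.on unif.

Let unif1 : unif setT = 1%E.
Proof. by rewrite /unif /mrestr setTI lebesgue_measure_itv /= lte01 sube0. Qed.

HB.instance Definition _ := @Measure_isProbability.Build _ _ R unif unif1.

Let mdigit i : measurable (digit @^-1` [set i]).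
Proof.
have mI (t : R) : measurable `]-oo, t[%classic by exact: measurable_itv.
case: (colorP i) => ->.
- rewrite [X in measurable X](_ : _ = `]-oo, p c0[%classic)//.
  apply/seteqP; split => x; rewrite /digit /= in_itv/=; case: ltP => // _.
  by case: ifP.
- rewrite [X in measurable X](_ : _ =
    ~` `]-oo, p c0[%classic `&` `]-oo, p c0 + p c1[%classic).
    by apply: measurableI => //; exact: measurableC.
  apply/seteqP; split => x; rewrite /digit /= !in_itv/=.
    by case: ltP => // _; case: ltP => //; split.
  by case=> /negP/negbTE -> ->.
- rewrite [X in measurable X](_ : _ =
    ~` `]-oo, p c0[%classic `&` ~` `]-oo, p c0 + p c1[%classic).
    by apply: measurableI => //; exact: measurableC.
  apply/seteqP; split => x; rewrite /digit /= !in_itv/=.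
    by case: ltP => // _; case: ltP => //; split.
  by case=> /negP/negbTE -> /negP/negbTE ->.
Qed.

Let mshift : measurable_fun setT shift.
Proof.
move=> _ Y mY; rewrite setTI.
have -> : shift @^-1` Y = \bigcup_(i in [set: color])
   (digit @^-1` [set i] `&` (fun x => (x - off i) / p i) @^-1` Y).
  apply/seteqP; split => [x Yx|x [i _ [/= <-]]//].
  by exists (digit x).
apply: fin_bigcup_measurable => // i _.
apply: measurableI => //; rewrite -[X in measurable X]setTI.
have mf : measurable_fun setT (fun x : R => (x - off i) / p i).
  by apply: measurable_funM => //; exact: measurable_funB.
exact: mf.
Qed.

Let mdg k i : measurable (dg k @^-1` [set i]).
Proof.
have mi : measurable_fun setT (iter k shift).
  elim: k => [|k IH]; first exact: measurable_id.
  by rewrite [iter _ _]/(shift \o iter k shift); exact: measurableT_comp.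
rewrite -[X in measurable X]setTI.
exact: (mi measurableT _ (mdigit i)).
Qed.

Let cyl (ks : seq nat) (f : nat -> color) : set R :=
  [set x | forall k, k \in ks -> dg k x = f k].

Let mcyl ks f : measurable (cyl ks f).
Proof.
elim: ks => [|k ks IH].
  by rewrite (_ : cyl _ _ = setT) //; apply/seteqP; split.
rewrite (_ : cyl _ _ = dg k @^-1` [set f k] `&` cyl ks f).
  by apply: measurableI => //; exact: mdg.
apply/seteqP; split => [x h|x [h1 h2] j].
  split; first by apply: h; exact: mem_head.
  by move=> j jk; apply: h; rewrite inE jk orbT.
by rewrite inE => /orP[/eqP -> //|]; exact: h2.
Qed.

Let unif_cyl (N m : nat) : forall (ks : seq nat) (f : nat -> color),
  uniq ks -> {subset ks <= iota 0 N} -> (N - size ks)%N = m ->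
  unif (cyl ks f) = (\prod_(k <- ks) p (f k))%:E.
Proof.
elim: m => [|m IH] ks f uks sub sz.
  have kE : perm_eq ks (iota 0 N).
    apply: uniq_perm (iota_uniq _ _) _ => //.
    have le : (size (iota 0 N) <= size ks)%N by rewrite size_iota -subn_eq0 sz.
    by have [] := uniq_min_size uks sub le.
  have [a [a0 ab H]] := prefix_itv N f.
  have -> : \prod_(k <- ks) p (f k) = \prod_(k < N) p (f k).
    by rewrite (perm_big _ kE) -(big_mkord xpredT (fun k => p (f k)))
      /index_iota subn0.
  set b := \prod_(_ < _) _ in ab H *.
  have -> : unif (cyl ks f) = mu `[a, a + b[%classic.
    rewrite /unif /mrestr; congr (mu _); apply/seteqP; split => x /=.
      rewrite !in_itv/= => -[h x01]; apply/H; split=> // k kN; apply: h.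
      by rewrite (perm_mem kE) mem_iota.
    rewrite !in_itv/= => /H[x01 h]; split=> // k.
    by rewrite (perm_mem kE) mem_iota add0n => /h.
  rewrite lebesgue_measure_itv/= lte_fin.
  case: ltP => h; first by rewrite -EFinB; congr EFin; lra.
  have b0 : 0 <= b by apply: prodr_ge0.
  by congr EFin; lra.
have /existsP[j jk] : [exists j : 'I_N, val j \notin ks].
  rewrite -[X in is_true X]negbK negb_exists; apply/negP => /forallP h.
  have : (size (iota 0 N) <= size ks)%N.
    apply: uniq_leq_size (iota_uniq _ _) _ => k.
    rewrite mem_iota add0n => kN.
    by have := h (Ordinal kN); rewrite negbK.
  by rewrite size_iota -subn_eq0 sz.
pose g i k := if k == val j then i else f k.
have gk i k : k \in ks -> g i k = f k.
  by rewrite /g => kk; case: eqP => // e; rewrite -e kk in jk.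
have -> : cyl ks f = \bigcup_(i in [set: color]) cyl (val j :: ks) (g i).
  apply/seteqP; split => [x h|x [i _ h] k kk].
    exists (dg (val j) x) => // k; rewrite inE => /orP[/eqP ->|kk].
      by rewrite /g eqxx.
    by rewrite gk//; apply: h.
  by rewrite -(gk i)//; apply: h; rewrite inE kk orbT.
rewrite measure_fin_bigcup; first last.
- by move=> i _; exact: mcyl.
- move=> i i' _ _ [x [h h']].
  have e := h (val j) (mem_head _ _); have e' := h' (val j) (mem_head _ _).
  by rewrite /g eqxx in e e'; rewrite -e -e'.
- exact: (@finite_finset color).
pose A : {fset color} := [fset i in index_enum color]%fset.
have inA i : i \in A by rewrite in_fset mem_index_enum.
rewrite (@fsbigTE _ _ _ _ A) => [|i]; last by rewrite inA.
have AE : perm_eq A (index_enum color).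
  apply: uniq_perm => [||i]; rewrite ?fset_uniq ?index_enum_uniq//.
  by rewrite mem_index_enum inA.
rewrite (perm_big _ AE).
transitivity (\sum_(i : color) (p i * \prod_(k <- ks) p (f k))%:E)%E.
  apply: eq_bigr => i _; apply: etrans (IH (val j :: ks) (g i) _ _ _) _.
  - by rewrite /= jk.
  - move=> k; rewrite inE => /orP[/eqP ->|/sub//].
    by rewrite mem_iota add0n ltn_ord.
  - by rewrite /= subnS sz.
  - rewrite big_cons {1}/g eqxx; congr (_ * _)%:E.
    by apply: eq_big_seq => k /gk ->.
by rewrite sumEFin -mulr_suml p_sum mul1r.
Qed.

Let X (x : measurableTypeR R) : coloring_space := fun v => dg (choice.pickle v) x.

Let mX : measurable_fun setT X.
Proof.
refine (@measurability _ _ (measurableTypeR R) coloring_space setT X cylinders erefl _).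
move=> _ [_ [v [i ->]] <-]; rewrite setTI; exact: (mdg (choice.pickle v) i).
Qed.

HB.instance Definition _ := isMeasurableFun.Build _ _ _ _ X mX.

Lemma exists_coloring_law :
  exists P : probability coloring_space R, is_coloring_law p P.
Proof.
exists (distribution unif X) => F c.
pose f k := if @choice.unpickle cell k is Some v then c v else ord0.
have fE v : f (choice.pickle v) = c v by rewrite /f choice.pickleK.
have e : X @^-1` [set w : coloring | forall v, v \in F -> w v = c v] =
    cyl [seq choice.pickle v | v <- F] f.
  apply/seteqP; split => x h.
    by move=> _ /mapP[v vF ->]; rewrite fE; apply: h.
  by move=> v vF; rewrite -fE; apply: h; exact: map_f.
set ks := map _ _ in e *.
apply: etrans (congr1 unif e) _.
have := @unif_cyl (\max_(k <- ks) k).+1 _ ks f _ _ erefl.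
move=> ->.
- by rewrite big_map; congr EFin; apply: eq_bigr => v _; rewrite fE.
- by rewrite map_inj_uniq ?fset_uniq//; exact: pcan_inj choice.pickleK.
- move=> k kks; rewrite mem_iota add0n ltnS.
  by rewrite (big_rem k) //= leq_maxl.
Qed.

End existence.

Lemma simplex_coloring_law (R : realType) (p : simplex R) :
  exists P : probability coloring_space R, is_coloring_law (sval p) P.
Proof.
case: p => p /= [p01 p1]; apply: exists_coloring_law => // i.
by have /andP[] := p01 i.
Qed.

Definition coloring_law (R : realType) (p : simplex R) :
    probability coloring_space R :=
  sval (cid (simplex_coloring_law p)).

Lemma coloring_lawP (R : realType) (p : simplex R) :
  is_coloring_law (sval p) (coloring_law p).
Proof. exact: (svalP (cid _)). Qed.

Lemma coloring_law_unique (R : realType) (p : color -> R)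
    (P Q : probability coloring_space R) :
  is_coloring_law p P -> is_coloring_law p Q ->
  forall A, measurable A -> P A = Q A.
Proof.
move=> hP hQ.
pose Z (F : {fset cell}) (c : coloring) : set coloring_space :=
  [set w : coloring | forall v, v \in F -> w v = c v].
pose G : set (set coloring_space) :=
  [set A | A = set0 \/ exists F c, A = Z F c].
have mZ F c : measurable (Z F c).
  rewrite [X in measurable X](_ : _ =
      ~` \bigcup_(v in [set` F]) ~` [set w : coloring | w v = c v]).
    apply: measurableC; apply: fin_bigcup_measurable => // v _.
    apply: measurableC; apply: (@sub_sigma_algebra _ setT cylinders).
    by exists v, (c v).
  rewrite setC_bigcup; apply/seteqP; split => w h v vF.
    by move=> /(_ (h v vF)).
  by apply: contrapT => hv; exact: (h v vF).
have Gm : [set X | G X /\ X `<=` setT] `<=` measurable.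
  by move=> _ [[->|[F [c ->]]] _]; [exact: measurable0|exact: mZ].
have GI : setI_closed [set X | G X /\ X `<=` setT].
  move=> A B [GA _] [GB _]; split => //.
  have [->|/set0P[w [Aw Bw]]] := eqVneq (A `&` B) set0; first by left.
  case: GA Aw => [->//|[F [c ->]]] Fw; case: GB Bw => [->//|[F' [c' ->]]] Fw'.
  right; exists (F `|` F')%fset, w; apply/seteqP; split => u.
    case=> h h' v; rewrite in_fsetU => /orP[vF|vF].
      by rewrite h// Fw.
    by rewrite h'// Fw'.
  move=> h; split => v vF; first by rewrite h ?Fw// in_fsetU vF.
  by rewrite h ?Fw'// in_fsetU vF orbT.
move=> A mA.
apply: (@g_sigma_algebra_measure_unique_trace _ R coloring_space G setT
  measurableT Gm GI P Q) => //.
- exact: etrans (probability_setT P) (esym (probability_setT Q)).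
- move=> _ [[->|[F [c ->]]] _]; first by rewrite !measure0.
  exact: etrans (hP F c) (esym (hQ F c)).
- apply: le_lt_trans (ltry 1).
  exact: (@probability_le1 _ _ _ P _ measurableT).
- suff : <<s cylinders >> `<=` <<s [set X | G X /\ X `<=` setT] >> by exact.
  apply: smallest_sub; first exact: smallest_sigma_algebra.
  move=> _ [v [i ->]]; apply: sub_sigma_algebra; split => //.
  right; exists [fset v]%fset, (fun=> i); apply/seteqP; split => w.
    by move=> h u; rewrite inE => /eqP ->.
  by move=> h; apply: h; rewrite inE.
Qed.

Definition compact_phase (R : realType) (p : simplex R) : Prop :=
  exists C c : R, [/\ 0 < C, 0 < c &
    forall n : nat, (1 <= n)%N ->
      (coloring_law p (crossing n) <= (C * expR (- c * n%:R))%:E)%E].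

Definition extended_phase (R : realType) (p : simplex R) : Prop :=
  exists c : R, 0 < c /\
    forall n : nat, (1 <= n)%N -> (c%:E <= coloring_law p (crossing n))%E.

(* Main.v *)
(* Fix n and let f(r) be the probability that a tricolor path joins the box
   [-n,n]^3 to the outside of [-r,r]^3. Stopping the path when it first leaves
   the larger box shows that P(E_n) = f(3n) and that E_n depends only on the
   colors in [-3n-2,3n+2]^3. If a path realizes the event of f(r+8n), then E_n
   occurs, and the part of the path after its last visit to [-3n-2,3n+2]^3 starts
   in [-3n-4,3n+4]^3, hence within one of 9^3 = 729 translates of [-n,n]^3 by
   vectors y in 2n {-4,...,4}^3, and goes from there to distance r from y using
   only cells outside [-3n-2,3n+2]^3. By independence and translation invariance,
   f(r+8n) <= 729 P(E_n) f(r), so that P(E_n) < 1/1458 makes f decay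
   exponentially. Finally a path realizing E_m starts at one of the at most
   (2m+1)^3 cells of [-m,m]^3 and reaches distance 2m from it, hence
   P(E_m) <= (2m+1)^3 f(2m). *)
From HB Require Import structures.
Require Import Defs.
From mathcomp Require Import all_boot all_order all_algebra finmap.
From mathcomp Require Import all_classical all_reals all_analysis.
From mathcomp Require Import zify lra ring.

Set Implicit Arguments.
Unset Strict Implicit.
Unset Printing Implicit Defensive.

Import Order.TTheory GRing.Theory Num.Theory.

Local Open Scope classical_set_scope.
Local Open Scope ring_scope.

(** * The cells as a translation group *)

Lemma in_latticeD (u v : 'rV[int]_3) :
  in_lattice u -> in_lattice v -> in_lattice (u + v).
Proof.
move=> /orP[]/forallP hu /orP[]/forallP hv; apply/orP; [left|right|right|left];
  apply/forallP => i; rewrite mxE; have := rpredD (hu i) (hv i) => //.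
- by rewrite addrA.
- by rewrite addrAC.
- by rewrite addrACA -opprD => h; rewrite -[_ + _](subrK (1 + 1)) rpredD.
Qed.

Lemma in_latticeN (v : 'rV[int]_3) : in_lattice v -> in_lattice (- v).
Proof.
move=> /orP[]/forallP hv; apply/orP; [left|right]; apply/forallP => i;
  rewrite mxE; first by rewrite rpredN; exact: hv.
by rewrite -opprD rpredN -[_ + _](subrK (1 + 1)) addrKA rpredD.
Qed.

Lemma in_lattice_even (v : 'rV[int]_3) : in_lattice (v *+ 2).
Proof.
apply/orP; left; apply/forallP => i; rewrite mulmxnE.
by apply/dvdzP; exists (v ord0 i); rewrite mulr_natr.
Qed.

Definition cell0 : cell := exist _ (0 *+ 2) (in_lattice_even 0).

Definition cellD (u v : cell) : cell :=
  exist _ (val u + val v) (in_latticeD (valP u) (valP v)).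

Definition cellN (v : cell) : cell := exist _ (- val v) (in_latticeN (valP v)).

Lemma cellNDK (u : cell) : cancel (cellD (cellN u)) (cellD u).
Proof. by move=> v; apply/val_inj; rewrite /= addrA subrr add0r. Qed.

Lemma cellDNK (u : cell) : cancel (cellD u) (cellD (cellN u)).
Proof. by move=> v; apply/val_inj; rewrite /= addrA addNr add0r. Qed.

Lemma adjacentD (u v w : cell) :
  Defs.adjacent (cellD u v) (cellD u w) = Defs.adjacent v w.
Proof.
by rewrite /Defs.adjacent /= opprD addrACA subrr add0r.
Qed.

(** Every margin [+ 2] in the box radii below comes from this bound. *)
Lemma adjacent_dist (v w : cell) : Defs.adjacent v w ->
  forall i, `|val v 0 i - val w 0 i| <= 2.
Proof.
have e i : val v 0 i - val w 0 i = (val v - val w) 0 i by rewrite !mxE.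
move=> /orP[/existsP[j /orP[]/eqP h] i|/forallP h i]; rewrite e.
- by rewrite h !mxE eqxx/=; case: eqP.
- by rewrite h !mxE eqxx/=; case: eqP.
- by rewrite (eqP (h i)).
Qed.

(** * Boxes in the sup norm *)

Definition box (y : cell) (r : nat) (v : cell) : bool :=
  [forall i, `|val v 0 i - val y 0 i| <= r%:Z].

Lemma boxE (y : cell) (r : nat) (v : cell) :
  box y r v = in_box r (cellD (cellN y) v).
Proof. by apply: eq_forallb => i /=; rewrite !mxE addrC. Qed.

Lemma box0E (r : nat) (v : cell) : box cell0 r v = in_box r v.
Proof. by apply: eq_forallb => i; rewrite /= mul0rn mxE subr0. Qed.

Lemma box_center (y : cell) (r : nat) : box y r y.
Proof. by apply/forallP => i; rewrite subrr normr0. Qed.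

Lemma box_le (y : cell) (r s : nat) (v : cell) : (r <= s)%N -> box y r v -> box y s v.
Proof. by move=> rs /forallP h; apply/forallP => i; move: (h i); lia. Qed.

Lemma box_trans (y z : cell) (r s : nat) (v : cell) :
  box y r z -> box z s v -> box y (r + s) v.
Proof. by move=> /forallP h /forallP k; apply/forallP => i; move: (h i) (k i); lia. Qed.

Lemma vertex_diam (x : {fset cell}) (y v w : cell) (r : nat) :
  is_vertex x -> v \in x -> w \in x -> box y r v -> box y (r + 2) w.
Proof.
move=> [_ adj] vx wx yv; apply: box_trans yv _.
have [->|vw] := eqVneq w v; first exact: box_center.
by apply/forallP; apply: adjacent_dist; exact: adj.
Qed.

(** An offset outside the lattice falls back on [cell0] and so yields [y]. Repetitions are harmless:
    the list serves for covering and for counting from above. *)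
Definition box_cells (y : cell) (r : nat) : seq cell :=
  [seq cellD y (insubd cell0 (\row_i ((g i : nat)%:Z - r%:Z))) |
    g : {ffun 'I_3 -> 'I_(2 * r).+1}].

Lemma size_box_cells (y : cell) (r : nat) : size (box_cells y r) = ((2 * r).+1 ^ 3)%N.
Proof. by rewrite size_map -cardT card_ffun !card_ord. Qed.

Lemma mem_box_cells (y : cell) (r : nat) (v : cell) :
  box y r v -> v \in box_cells y r.
Proof.
move=> /forallP h; apply/mapP.
pose g := [ffun i => inord (absz (val v 0 i - val y 0 i + r%:Z)%R)]
  : {ffun 'I_3 -> 'I_(2 * r).+1}.
exists g; first by rewrite mem_enum.
apply/val_inj => /=; rewrite val_insubd.
have -> : (\row_i ((g i : nat)%:Z - r%:Z)) = - val y + val v.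
  apply/rowP => i; rewrite !mxE ffunE.
  move: (h i); move: (val v 0 i : int) (val y 0 i : int) => a b ab.
  by rewrite inordK; lia.
by rewrite in_latticeD ?in_latticeN ?(valP v) ?(valP y)// addrA subrr add0r.
Qed.

Definition boxF (y : cell) (r : nat) : {fset cell} :=
  [fset v in box_cells y r | box y r v]%fset.

Lemma in_boxF (y : cell) (r : nat) (v : cell) : (v \in boxF y r) = box y r v.
Proof. by rewrite !inE andb_idl//; exact: mem_box_cells. Qed.

(** * Tricolor paths leaving boxes, and the events they define *)

Lemma step_vertex (w : coloring) (x y : {fset cell}) :
  tricolor_step w x y -> is_vertex y.
Proof. by move=> /asboolP[]. Qed.

Lemma step_common_cell (w : coloring) (x y : {fset cell}) :
  tricolor_step w x y -> exists2 v, v \in x & v \in y.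
Proof.
move=> /asboolP[_ _ _ [e [[[e3 _] _] /fsubsetP ex /fsubsetP ey]]].
have [e0|[v ve]] := fset_0Vmem e; first by rewrite e0 cardfs0 in e3.
by exists v; [exact: ex|exact: ey].
Qed.

Lemma last_vertex (w : coloring) (x : {fset cell}) (s : seq {fset cell}) :
  is_vertex x -> path (tricolor_step w) x s -> is_vertex (last x s).
Proof.
elim: s x => //= z s IH x _ /andP[/step_vertex vz]; exact: IH.
Qed.

(** A vertex that both touches a box and leaves it lies on the boundary of that box. *)
Definition touches (y : cell) (r : nat) (x : {fset cell}) : Prop :=
  exists2 v, v \in x & box y r v.

Definition leaves (y : cell) (r : nat) (x : {fset cell}) : Prop :=
  exists2 v, v \in x & ~~ box y r v.

Lemma touches_sub (y : cell) (r : nat) (x : {fset cell}) :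
  is_vertex x -> touches y r x -> (x `<=` boxF y (r + 2))%fset.
Proof.
move=> vx [v vinx yv]; apply/fsubsetP => u ux; rewrite in_boxF.
exact: vertex_diam vx vinx ux yv.
Qed.

Lemma touches_not_leaves (y : cell) (r q : nat) (x : {fset cell}) :
  is_vertex x -> (r + 2 <= q)%N -> touches y r x -> ~ leaves y q x.
Proof.
move=> vx rq /(touches_sub vx)/fsubsetP h [v /h]; rewrite in_boxF => /(box_le rq) k.
by rewrite k.
Qed.

Lemma leaves_le (y : cell) (r q : nat) (x : {fset cell}) :
  (r <= q)%N -> leaves y q x -> leaves y r x.
Proof.
by move=> rq [v vx h]; exists v => //; apply: contra h; exact: box_le.
Qed.

Lemma touches_le (y : cell) (r q : nat) (x : {fset cell}) :
  (r <= q)%N -> touches y r x -> touches y q x.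
Proof. by move=> rq [v vx h]; exists v => //; exact: box_le h. Qed.

(** Before the first vertex that leaves the box, all cells lie in it, so the cell shared with the
    preceding vertex makes the exit vertex touch the box too. This confines the path to radius
    [r + 2]. *)
Lemma first_exit (w : coloring) (y : cell) (r : nat) (x : {fset cell})
    (s : seq {fset cell}) :
  is_vertex x -> path (tricolor_step w) x s ->
  touches y r x -> leaves y r (last x s) ->
  exists s1 s2, [/\ s = s1 ++ s2,
    all (fun z => (z `<=` boxF y (r + 2))%fset) (x :: s1),
    touches y r (last x s1) & leaves y r (last x s1)].
Proof.
elim: s x => [|z s IH] x vx.
  move=> _ tx lx; exists [::], [::]; split => //=.
  by rewrite touches_sub.
move=> /= /andP[xz zs] tx lz.
have [lx|nlx] := pselect (leaves y r x).
  by exists [::], (z :: s); split => //=; rewrite touches_sub.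
have tz : touches y r z.
  have [v vinx vinz] := step_common_cell xz; exists v => //.
  by apply: contrapT => /negP h; apply: nlx; exists v.
have [s1 [s2 [-> a1 t1 l1]]] := IH z (step_vertex xz) zs tz lz.
by exists (z :: s1), s2; split => //; rewrite /= touches_sub.
Qed.

(** Here [z] is the successor of the last vertex that touches the box; the cell they share gives the
    radius [q + 2]. The first alternative is a path that avoids the box. *)
Lemma last_exit (w : coloring) (y : cell) (q : nat) (x : {fset cell})
    (s : seq {fset cell}) :
  is_vertex x -> path (tricolor_step w) x s -> ~ touches y q (last x s) ->
  {in x :: s, forall z, ~ touches y q z} \/
  exists s1 z s2, [/\ s = s1 ++ z :: s2, is_vertex z, touches y (q + 2) z &
    {in z :: s2, forall u, ~ touches y q u}].
Proof.
elim: s x => [|z s IH] x vx; first by move=> _ nt; left => u; rewrite inE => /eqP ->.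
move=> /= /andP[xz zs] nt; have vz := step_vertex xz.
have [h|[s1 [u [s2 [-> vu tu h]]]]] := IH z vz zs nt; last first.
  by right; exists (z :: s1), u, s2.
have [tx|ntx] := pselect (touches y q x); last first.
  by left => u; rewrite inE => /orP[/eqP ->//|]; exact: h.
right; exists [::], z, s; split => //.
have [v vinx vinz] := step_common_cell xz; exists v => //.
by rewrite -in_boxF; apply: (fsubsetP (touches_sub vx tx)).
Qed.

(* Restricting all the cells of the path to a finite set S makes the event
   depend on finitely many colors, so that disjoint sets S give independence. *)
Definition reach (S : {fset cell}) (y : cell) (n r : nat) : set coloring_space :=
  [set w : coloring | exists x s, [/\ is_vertex x, path (tricolor_step w) x s,
    all (fun z => (z `<=` S)%fset) (x :: s), touches y n x &
    leaves y r (last x s)]].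

Definition depends_on (F : {fset cell}) (A : set coloring_space) : Prop :=
  forall w w' : coloring, {in F, w =1 w'} -> A w -> A w'.

(** The coloring enters only through the edges, whose cells belong to the vertices they join and
    hence to [S]. *)
Lemma reach_depends_on (S : {fset cell}) (y : cell) (n r : nat) :
  depends_on S (reach S y n r).
Proof.
move=> w w' ww' [x [s [vx xs al tx ls]]]; exists x, s; split => //.
elim: s x vx xs al {tx ls} => //= z s IH x vx /andP[xz zs] /and3P[xS zS sS].
rewrite IH//=; [|exact: step_vertex xz|by rewrite zS].
rewrite andbT; move/asboolP: xz => [_ vz nxz [e [[ee inj] ex ez]]].
apply/asboolP; split => //; exists e; split => //; split => // u v ue ve.
have eS := fsubsetP (fsubset_trans ex xS).
by rewrite -!ww' ?eS//; exact: inj.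
Qed.

(** Stopping at the first exit replaces an arbitrary [S] by a box fixed in advance. *)
Lemma reach_le (w : coloring) (S : {fset cell}) (y : cell) (n r q : nat) :
  (n <= r <= q)%N -> reach S y n q w -> reach (boxF y (r + 2)) y n r w.
Proof.
move=> /andP[nr rq] [x [s [vx xs al tx ls]]].
have [s1 [s2 [es a1 _ l1]]] :=
  first_exit vx xs (touches_le nr tx) (leaves_le rq ls).
exists x, s1; split => //.
by move: xs; rewrite es cat_path => /andP[].
Qed.

Lemma reach_crossing (w : coloring) (S : {fset cell}) (n r : nat) :
  (0 < n)%N -> (3 * n <= r)%N -> reach S cell0 n r w -> crossing n w.
Proof.
move=> n0 nr [x [s [vx xs _ tx ls]]].
(* A vertex touching the inner box has all its cells in the outer box. So the first exit vertex has
   a cell in the annulus, and a vertex leaving the outer box has no cell in the inner one. *)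
have n23 : (n + 2 <= 3 * n)%N by lia.
have [s1 [s2 [es _ t1 l1]]] : exists s1 s2, [/\ s = s1 ++ s2,
    all (fun z => (z `<=` boxF cell0 (n + 2))%fset) (x :: s1),
    touches cell0 n (last x s1) & leaves cell0 n (last x s1)].
  by apply: first_exit vx xs tx (leaves_le _ ls); lia.
move: xs; rewrite es cat_path => /andP[p1 p2].
have v1 := last_vertex vx p1.
have l2 : leaves cell0 (3 * n) (last (last x s1) s2).
  by rewrite -last_cat -es; exact: leaves_le ls.
have t2 : touches cell0 (3 * n) (last x s1) by apply: touches_le t1; lia.
have [s3 [s4 [es2 _ t3 l3]]] := first_exit v1 p2 t2 l2.
move: p2; rewrite es2 cat_path => /andP[p3 _].
exists (last x s1), (last (last x s1) s3); split; last by exists s3.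
  case: t1 (touches_sub v1 t1) l1 => v v1x vn /fsubsetP sub [u u1 un]; split => //.
    exists u => //; rewrite /in_annulus -!box0E un andbT.
    by move: (sub u u1); rewrite in_boxF; exact: box_le.
  by exists v => //; rewrite -box0E.
have v3 := last_vertex v1 p3.
split => //; last by case: l3 => u u3 h; exists u; rewrite -?box0E.
case: t3 => v v3x vn; exists v => //; rewrite /in_annulus -!box0E vn/=.
by apply/negP => h; apply: (touches_not_leaves v3 n23 _ l3); exists v.
Qed.

Lemma crossingE (n : nat) : (0 < n)%N ->
  crossing n = reach (boxF cell0 (3 * n + 2)) cell0 n (3 * n).
Proof.
move=> n0; apply/seteqP; split => w; last exact: reach_crossing.
move=> [x [y [[vx _ [v vinx vn]] [_ _ [u uy un]] [s [xs ly]]]]].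
(* The union of the vertices of the path is a provisional [S], which [reach_le] then turns into a
   box. *)
pose S := (\big[fsetU/fset0]_(z <- x :: s) z)%fset.
apply: (@reach_le w S _ _ _ (3 * n)); first by lia.
exists x, s; split => //.
- by apply/allP => z zs; apply: bigfcup_sup.
- by exists v; rewrite ?box0E.
- by rewrite ly; exists u; rewrite ?box0E.
Qed.

(** * Covering by translated boxes and splitting of long paths *)

(** Doubling puts the point in the lattice, and the spacing [2 * n] is the width of a box of radius
    [n]. *)
Definition center (n : nat) (g : {ffun 'I_3 -> 'I_9}) : cell :=
  exist _ ((\row_i (n%:Z * ((g i : nat)%:Z - 4))) *+ 2) (in_lattice_even _).

Definition centers (n : nat) : seq cell :=
  [seq center n g | g : {ffun 'I_3 -> 'I_9}].

Lemma size_centers (n : nat) : size (centers n) = 729%N.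
Proof. by rewrite size_map -cardT card_ffun !card_ord. Qed.

Lemma center_box (n : nat) (y : cell) :
  y \in centers n -> box cell0 (8 * n) y.
Proof.
move=> /mapP[g _ ->]; rewrite box0E; apply/forallP => i /=.
rewrite mulmxnE mxE; case: (g i) => k /= k9; nia.
Qed.

Lemma centers_cover (n : nat) (v : cell) : (0 < n)%N ->
  box cell0 (7 * n) v -> exists2 y, y \in centers n & box y n v.
Proof.
move=> n0; rewrite box0E => /forallP h.
(* The interval $[2nk-9n,2nk-7n)$ has midpoint $2n(k-4)$; the quotient is the index [k] of the one
   containing [a]. *)
pose f (a : int) : nat := (absz (a + (9 * n)%N%:Z)%R %/ (2 * n))%N.
have fP (a : int) : `|a| <= (7 * n)%N%:Z ->
    (f a < 9)%N /\ `|a - (n%:Z * ((f a)%:Z - 4)) *+ 2| <= n%:Z.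
  rewrite /f => ha.
  have n2 : (0 < 2 * n)%N by lia.
  have := divn_eq (absz (a + (9 * n)%N%:Z)%R) (2 * n).
  have := ltn_pmod (absz (a + (9 * n)%N%:Z)%R) n2.
  set q := (_ %/ _)%N; set r := (_ %% _)%N => rn eq.
  split; nia.
pose g := [ffun i => inord (f (val v 0 i))] : {ffun 'I_3 -> 'I_9}.
exists (center n g); first by apply/mapP; exists g => //; rewrite mem_enum.
apply/forallP => i /=; have [f9 d] := fP _ (h i).
by rewrite mulmxnE mxE ffunE inordK.
Qed.

Lemma reach_split (w : coloring) (n r : nat) : (0 < n <= r)%N ->
  reach (boxF cell0 (r + 8 * n + 2)) cell0 n (r + 8 * n) w ->
  crossing n w /\ exists2 y, y \in centers n &
    reach (boxF y (r + 2) `\` boxF cell0 (3 * n + 2))%fset y n r w.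
Proof.
move=> /andP[n0 nr] h; split; first by apply: reach_crossing h; lia.
case: h => x [s [vx xs _ tx ls]].
have nt : ~ touches cell0 (3 * n + 2) (last x s).
  by move=> t; apply: touches_not_leaves t ls; [exact: last_vertex xs|lia].
have [|[s1 [z [s2 [es vz [c cz c7] nts]]]]] := last_exit vx xs nt.
  move=> /(_ x (mem_head _ _)) []; apply: touches_le tx; lia.
(* The cell [c] lies in radius [3 * n + 4], at most [7 * n] since [n] is positive. *)
have [y yc yn] : exists2 y, y \in centers n & box y n c.
  by apply: centers_cover => //; apply: box_le c7; lia.
exists y => //.
have ps2 : path (tricolor_step w) z s2.
  by move: xs; rewrite es cat_path /= => /and3P[].
have ty : touches y n z by exists c.
(* The center [y] is within [8 * n] of the origin, whence the increment [8 * n] of the radius. *)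
have ly : leaves y r (last z s2).
  move: ls; rewrite es last_cat /= => -[u ul un]; exists u => //.
  by apply: contra un; rewrite addnC; apply: box_trans; exact: center_box.
have [s3 [s4 [es2 a3 _ l3]]] := first_exit vz ps2 (touches_le nr ty) ly.
exists z, s3; split => //; first by move: ps2; rewrite es2 cat_path => /andP[].
apply/allP => u us; rewrite fsubsetD (allP a3 u us)/=.
apply/fdisjointP => v vu; rewrite in_boxF; apply/negP => vb.
apply: (nts u _); last by exists v.
by rewrite es2 -cat_cons mem_cat us.
Qed.

Lemma crossing_cover (w : coloring) (n m r : nat) :
  (0 < m)%N -> (n <= r <= 2 * m)%N -> crossing m w ->
  exists2 v, v \in box_cells cell0 m & reach (boxF v (r + 2)) v n r w.
Proof.
move=> m0 nrm; rewrite crossingE//.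
move=> [x [s [vx xs al [v vinx vm] [u ul um]]]].
exists v; first exact: mem_box_cells.
apply: (@reach_le w (boxF cell0 (3 * m + 2)) _ _ _ (2 * m)) => //.
exists x, s; split => //; first by exists v => //; exact: box_center.
exists u => //; apply: contra um => h.
by rewrite (_ : (3 * m = m + 2 * m)%N); [exact: box_trans vm h|lia].
Qed.

(** * Translation of colorings *)

(** Pulling the colors back along [cellD u] moves the picture by the opposite vector, hence the
    [cellN] in the lemmas on steps and paths. *)
Definition translate (u : cell) (w : coloring) : coloring := fun v => w (cellD u v).

Lemma cellDI (u : cell) : injective (cellD u).
Proof. exact: can_inj (cellDNK u). Qed.

Lemma mem_translate (u v : cell) (x : {fset cell}) :
  (cellD u v \in (cellD u @` x)%fset) = (v \in x).
Proof. by apply: mem_imfset; exact: cellDI. Qed.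

Lemma translate_clique (u : cell) (x : {fset cell}) :
  mutually_adjacent x -> mutually_adjacent (cellD u @` x)%fset.
Proof.
move=> adj _ _ /imfsetP[v vx ->] /imfsetP[v' vx' ->] ne.
by rewrite adjacentD; apply: adj => //; apply: contraNneq ne => ->.
Qed.

Lemma card_translate (u : cell) (x : {fset cell}) : #|` (cellD u @` x)%fset| = #|` x|.
Proof. by rewrite card_imfset//; exact: cellDI. Qed.

Lemma translate_vertex (u : cell) (x : {fset cell}) :
  is_vertex x -> is_vertex (cellD u @` x)%fset.
Proof. by move=> [c adj]; split; [rewrite card_translate|exact: translate_clique]. Qed.

Lemma translate_step (u : cell) (w : coloring) (x z : {fset cell}) :
  tricolor_step w x z ->
  tricolor_step (translate u w) (cellD (cellN u) @` x)%fset
    (cellD (cellN u) @` z)%fset.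
Proof.
move=> /asboolP[vx vz xz [e [[[e3 adj] inj] ex ez]]]; apply/asboolP; split.
- exact: translate_vertex.
- exact: translate_vertex.
- apply: contraNneq xz => eq_xz; apply/eqP/fsetP => v.
  by rewrite -(mem_translate (cellN u)) eq_xz mem_translate.
exists (cellD (cellN u) @` e)%fset; split; last first.
- apply/fsubsetP => _ /imfsetP[v ve ->].
  by rewrite mem_translate; exact: (fsubsetP ez).
- apply/fsubsetP => _ /imfsetP[v ve ->].
  by rewrite mem_translate; exact: (fsubsetP ex).
split; first by split; [rewrite card_translate|exact: translate_clique].
move=> _ _ /imfsetP[v ve ->] /imfsetP[v' ve' ->].
by rewrite /translate !cellNDK => /(inj v v' ve ve') ->.
Qed.

(** Besides recentering, this enlarges [S] to a full box, which fills the hole cut out in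
    [reach_split]. *)
Lemma reach_translate (w : coloring) (y : cell) (n r q : nat) (S : {fset cell}) :
  (S `<=` boxF y q)%fset -> reach S y n r w ->
  reach (boxF cell0 q) cell0 n r (translate y w).
Proof.
move=> /fsubsetP Sq [x [s [vx xs al [v vinx vn] [u ul ur]]]].
pose f (z : {fset cell}) := (cellD (cellN y) @` z)%fset.
exists (f x), (map f s); split.
- exact: translate_vertex.
- rewrite path_map; apply: sub_path xs => a b; exact: translate_step.
- rewrite -map_cons all_map; apply: sub_all al => z /= /fsubsetP zS.
  apply/fsubsetP => _ /imfsetP[a az ->]; rewrite in_boxF box0E -boxE -in_boxF.
  by apply/Sq/zS.
- by exists (cellD (cellN y) v); rewrite /f ?mem_translate// box0E -boxE.
- by rewrite last_map; exists (cellD (cellN y) u); rewrite /f ?mem_translate// box0E -boxE.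
Qed.

(** * Events depending on finitely many cells *)

Definition cylinder (F : {fset cell}) (c : coloring) : set coloring_space :=
  [set w : coloring | forall v, v \in F -> w v = c v].

Lemma measurable_cylinder (F : {fset cell}) (c : coloring) :
  measurable (cylinder F c).
Proof.
rewrite [X in measurable X](_ : _ =
    ~` \bigcup_(v in [set` F]) ~` [set w : coloring | w v = c v]).
  apply: measurableC; apply: fin_bigcup_measurable => // v _.
  apply: measurableC; apply: (@sub_sigma_algebra _ setT cylinders).
  by exists v, (c v).
rewrite setC_bigcup; apply/seteqP; split => w h v vF.
  by move=> /(_ (h v vF)).
by apply: contrapT => hv; exact: (h v vF).
Qed.

Definition extend (F : {fset cell}) (d : {ffun F -> color}) : coloring :=
  fun v => if insub v is Some v' then d v' else ord0.

Lemma extendE (F : {fset cell}) (w : coloring) :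
  {in F, extend [ffun v : F => w (val v)] =1 w}.
Proof. by move=> v vF; rewrite /extend insubT ffunE. Qed.

Lemma extend_inj (F : {fset cell}) (d d' : {ffun F -> color}) :
  {in F, extend d =1 extend d'} -> d = d'.
Proof. by move=> h; apply/ffunP => v; have := h _ (valP v); rewrite /extend valK. Qed.

(** Sorting the colorings of [A] by their restriction to [F] gives a finite union, which reduces
    measurability and independence to cylinders. The default color of [extend] outside [F] does not
    affect [cylinder F]. *)
Lemma depends_on_bigcup (F : {fset cell}) (A : set coloring_space) : depends_on F A ->
  A = \bigcup_(d in [set d : {ffun F -> color} | A (extend d)])
    cylinder F (extend d).
Proof.
move=> dA; apply/seteqP; split => [w Aw|w [d Ad wd]].
  exists [ffun v : F => w (val v)] => [/=|v vF]; last by rewrite extendE.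
  by apply: dA Aw => v vF; rewrite extendE.
by apply: dA Ad => v vF; rewrite wd.
Qed.

Lemma depends_on_measurable (F : {fset cell}) (A : set coloring_space) :
  depends_on F A -> measurable A.
Proof.
move=> /depends_on_bigcup ->; apply: fin_bigcup_measurable => [|d _].
  exact: (@finite_finset {ffun F -> color}).
exact: measurable_cylinder.
Qed.

(** * Independence, translation invariance and the union bound *)

Section law.
Variables (R : realType) (p : color -> R) (P : probability coloring_space R).
Hypothesis lawP : is_coloring_law p P.

(** Additivity over the disjoint cylinders that make up [B]. *)
Lemma indep_of_cylinders (F : {fset cell}) (A B : set coloring_space) :
  measurable A -> depends_on F B ->
  (forall c, P (A `&` cylinder F c) = (P A * P (cylinder F c))%E) ->
  P (A `&` B) = (P A * P B)%E.
Proof.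
move=> mA dB h; have eB := depends_on_bigcup dB.
have fin : finite_set [set d : {ffun F -> color} | B (extend d)].
  exact: (@finite_finset {ffun F -> color}).
have tr : trivIset [set d : {ffun F -> color} | B (extend d)]
    (fun d => cylinder F (extend d)).
  move=> d d' _ _ [w [wd wd']]; apply: extend_inj => v vF.
  by rewrite -wd// -wd'.
rewrite {1}eB setI_bigcupr measure_fin_bigcup//; first last.
- by move=> d _; apply: measurableI => //; exact: measurable_cylinder.
- by move=> d d' Bd Bd' [w [[_ wd] [_ wd']]]; apply: tr => //; exists w.
rewrite [in RHS]eB measure_fin_bigcup//; last by move=> d _; exact: measurable_cylinder.
by rewrite ge0_mule_fsumr//; apply: eq_fsbigr => d _; exact: h.
Qed.

Lemma cylinder_indep (F G : {fset cell}) (c d : coloring) : [disjoint F & G]%fset ->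
  P (cylinder F c `&` cylinder G d) = (P (cylinder F c) * P (cylinder G d))%E.
Proof.
(* Gluing [c] on [F] to [d] on [G] makes the intersection a single cylinder, whose product formula
   splits by disjointness. *)
move=> FG; pose e v := if v \in F then c v else d v.
have eG v : v \in G -> e v = d v.
  by move=> vG; rewrite /e (negbTE (fdisjointP_sym FG v vG)).
have eF v : v \in F -> e v = c v by rewrite /e => ->.
have -> : cylinder F c `&` cylinder G d = cylinder (F `|` G)%fset e.
  apply/seteqP; split => [w [wF wG] v|w h].
    by rewrite in_fsetU => /orP[vF|vG]; [rewrite eF// wF|rewrite eG// wG].
  split => v hv; first by rewrite -eF// h// in_fsetU hv.
  by rewrite -eG// h// in_fsetU hv orbT.
rewrite [LHS]lawP [X in _ = (X * _)%E]lawP [X in _ = (_ * X)%E]lawP -EFinM; congr EFin.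
rewrite (perm_big (F ++ G)).
  rewrite big_cat/=; congr (_ * _); apply: eq_big_seq => v hv.
    by rewrite eF.
  by rewrite eG.
apply: uniq_perm => [||v]; rewrite ?fset_uniq ?cat_uniq ?fset_uniq//=.
  rewrite andbT; apply/hasPn => v; exact: (fdisjointP_sym FG).
by rewrite mem_cat in_fsetU.
Qed.

(** Cylinders are extended to general events one factor at a time: first [B], then [A] against a
    fixed cylinder of [G]. *)
Lemma depends_on_indep (F G : {fset cell}) (A B : set coloring_space) :
  depends_on F A -> depends_on G B -> [disjoint F & G]%fset ->
  P (A `&` B) = (P A * P B)%E.
Proof.
move=> dA dB FG; apply: (indep_of_cylinders _ dB) => [|d].
  exact: depends_on_measurable dA.
rewrite setIC muleC; apply: (indep_of_cylinders _ dA) => [|c].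
  exact: measurable_cylinder.
by rewrite setIC muleC cylinder_indep.
Qed.

Lemma measurable_translate (y : cell) :
  measurable_fun setT (translate y : coloring_space -> coloring_space).
Proof.
refine (@measurability _ _ coloring_space coloring_space setT (translate y)
  cylinders erefl _).
move=> _ [_ [v [i ->]] <-]; rewrite setTI.
apply: (@sub_sigma_algebra _ setT cylinders).
by exists (cellD y v), i.
Qed.

(** The image law gives every cylinder the same product, so [coloring_law_unique] identifies it with
    [P]. *)
Lemma translate_law (y : cell) (A : set coloring_space) : measurable A ->
  P (translate y @^-1` A) = P A.
Proof.
pose T := HB.pack_for {mfun coloring_space >-> coloring_space} (translate y)
  (isMeasurableFun.Build _ _ _ _ (translate y : coloring_space -> coloring_space)
    (measurable_translate y)).
apply: (@coloring_law_unique R p (distribution P T) P) => // F c.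
pose c' v := c (cellD (cellN y) v).
have e : T @^-1` cylinder F c = cylinder (cellD y @` F)%fset c'.
  apply/seteqP; split => w h.
    by move=> _ /imfsetP[v vF ->]; rewrite /c' cellDNK -h.
  by move=> v vF; rewrite /= /translate h ?mem_translate// /c' cellDNK.
rewrite [LHS](congr1 P e) [LHS]lawP; congr EFin.
rewrite (perm_big [seq cellD y v | v <- F]).
  by rewrite big_map; apply: eq_bigr => v _; rewrite /c' cellDNK.
apply: uniq_perm => [||v]; rewrite ?fset_uniq ?map_inj_uniq ?fset_uniq//.
  exact: cellDI.
apply/imfsetP/mapP => -[u uF ->]; by exists u.
Qed.

Lemma measurable_reach (S : {fset cell}) (y : cell) (n r : nat) :
  measurable (reach S y n r).
Proof. exact: depends_on_measurable (@reach_depends_on S y n r). Qed.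

Lemma law_reach_translate (y : cell) (n r q : nat) (S : {fset cell}) :
  (S `<=` boxF y q)%fset ->
  (P (reach S y n r) <= P (reach (boxF cell0 q) cell0 n r))%E.
Proof.
move=> Sq; rewrite -[leRHS](translate_law y (measurable_reach _ _ _ _)).
apply: le_measure => [||w]; rewrite ?inE.
- exact: measurable_reach.
- rewrite -[X in measurable X]setTI; apply: measurable_translate => //.
  exact: measurable_reach.
- exact: reach_translate.
Qed.

Lemma union_bound (I : eqType) (s : seq I) (F : I -> set coloring_space)
    (A : set coloring_space) (b : \bar R) :
  measurable A -> (forall i, measurable (F i)) ->
  (forall w, A w -> exists2 i, i \in s & F i w) ->
  {in s, forall i, (P (F i) <= b)%E} -> (P A <= (size s)%:R%:E * b)%E.
Proof.
elim: s A => [|i s IH] A mA mF AF Fb.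
  rewrite mul0e (_ : A = set0) ?measure0//.
  by apply/seteqP; split => // w /AF[].
have b0 : (0 <= b)%E by apply: le_trans (Fb i (mem_head _ _)).
(* The second piece is covered by the events of the remaining list. *)
have -> : A = (A `&` F i) `|` (A `\` F i) by rewrite setUIDK.
apply: le_trans (measureU2 _ _ _) _; [exact: measurableI|exact: measurableD|].
rewrite /= -add1n natrD EFinD ge0_muleDl// mul1e; apply: leeD.
  apply: le_trans (Fb i (mem_head _ _)); apply: le_measure; rewrite ?inE//.
  exact: measurableI.
apply: IH => //.
- exact: measurableD.
- move=> w [/AF[j]]; rewrite inE => /orP[/eqP ->//|js Fj _]; by exists j.
- by move=> j js; apply: Fb; rewrite inE js orbT.
Qed.

(** * Recursion in the radius and exponential decay *)

Lemma reach_recursion (n r : nat) : (0 < n <= r)%N ->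
  (P (reach (boxF cell0 (r + 8 * n + 2)) cell0 n (r + 8 * n)) <=
   729%:R%:E * (P (crossing n) * P (reach (boxF cell0 (r + 2)) cell0 n r)))%E.
Proof.
move=> nr; have n0 : (0 < n)%N by case/andP: nr.
rewrite -(size_centers n).
pose S y := (boxF y (r + 2) `\` boxF cell0 (3 * n + 2))%fset.
have dE : depends_on (boxF cell0 (3 * n + 2)) (crossing n).
  by rewrite crossingE//; exact: reach_depends_on.
apply: (@union_bound _ _ (fun y => crossing n `&` reach (S y) y n r)).
- exact: measurable_reach.
- move=> y; apply: measurableI; last exact: measurable_reach.
  exact: depends_on_measurable dE.
- move=> w /(reach_split nr)[Ew [y yc yw]]; by exists y.
move=> y _; rewrite (depends_on_indep dE (@reach_depends_on (S y) y n r)).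
  by rewrite lee_wpmul2l//; apply: law_reach_translate; exact: fsubsetDl.
apply/fdisjointP => v vb; by rewrite inE vb.
Qed.

Lemma reach_decay (n : nat) (a : R) (j : nat) : (0 < n)%N -> 0 <= a ->
  (P (crossing n) <= a%:E)%E ->
  (P (reach (boxF cell0 (3 * n + 8 * n * j + 2)) cell0 n (3 * n + 8 * n * j)) <=
   ((729%:R * a) ^+ j)%:E)%E.
Proof.
move=> n0 a0 Pa; elim: j => [|j IH].
  by rewrite expr0; apply: probability_le1; exact: measurable_reach.
rewrite (_ : (3 * n + 8 * n * j.+1 = 3 * n + 8 * n * j + 8 * n)%N); last by lia.
apply: le_trans (reach_recursion _) _; first by lia.
move: (ler0n R 729) IH; move: (729%:R : R) => N N0 IH.
by rewrite exprS -mulrA EFinM; apply: lee_wpmul2l => //; rewrite EFinM lee_pmul.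
Qed.

Lemma crossing_decay (n m j : nat) (a : R) :
  (0 < n)%N -> (0 < m)%N -> (3 * n + 8 * n * j <= 2 * m)%N -> 0 <= a ->
  (P (crossing n) <= a%:E)%E ->
  (P (crossing m) <= (((2 * m).+1%:R ^+ 3) * (729%:R * a) ^+ j)%:E)%E.
Proof.
move=> n0 m0 nm a0 Pa; rewrite -natrX EFinM -(size_box_cells cell0 m).
pose r := (3 * n + 8 * n * j)%N.
apply: (@union_bound _ _ (fun v => reach (boxF v (r + 2)) v n r)).
- rewrite crossingE//; exact: measurable_reach.
- move=> v; exact: measurable_reach.
- move=> w; apply: crossing_cover => //; lia.
move=> v _; apply: le_trans (reach_decay j n0 a0 Pa).
exact: law_reach_translate.
Qed.

End law.

(** The factor [2^-1 ^+ j] decays in [m] at rate at least [2 * c], twice the rate claimed; half of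
    it absorbs the cubic prefactor. *)
Lemma compact_of_small_crossing (R : realType) (p : simplex R) (n : nat) (a : R) :
  (0 < n)%N -> 0 <= a -> 729%:R * a = 2^-1 ->
  (coloring_law p (crossing n) < a%:E)%E -> compact_phase p.
Proof.
move=> n0 a0 aE small.
have n0' : (0 : R) < n%:R by rewrite ltr0n.
pose c : R := (16 * n%:R)^-1.
have c0 : 0 < c by rewrite invr_gt0 mulr_gt0.
exists (expR 1 * (1 + 6 / c) ^+ 3), c; split => //.
  by rewrite mulr_gt0 ?expR_gt0// exprn_gt0// addr_gt0// divr_gt0.
move=> m m0.
(* The predecessor leaves room for the initial radius [3 * n]. If it is 0, possibly by truncation,
   the bound is at least 1 and holds trivially. *)
pose j := ((2 * m) %/ (8 * n)).-1.
have Pm : (coloring_law p (crossing m) <= ((2 * m).+1%:R ^+ 3 * (2^-1) ^+ j)%:E)%E.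
  have := divn_eq (2 * m) (8 * n).
  case j0 : j => [|j'] eq_m.
    rewrite expr0 mulr1; apply: le_trans (_ : 1 <= _)%E.
      apply: probability_le1; rewrite crossingE//; exact: measurable_reach.
    by rewrite lee_fin -natrX ler1n expn_gt0.
  rewrite -aE; apply: (crossing_decay (coloring_lawP p) n0 m0 _ a0 (ltW small)).
  rewrite -j0 /j.
  move: j0 eq_m; rewrite /j; case: (_ %/ _)%N => // k _ ->.
  by rewrite /=; nia.
apply: le_trans Pm _; rewrite lee_fin => {a a0 aE small}.
have half : (2^-1 : R) <= expR (- 2^-1).
  by have := expR_ge1Dx (- 2^-1 : R); lra.
(* j >= m / (4 n) - 2 and c = 1 / (16 n), hence j / 2 >= 2 c m - 1. *)
have hj : (2^-1 : R) ^+ j <= expR 1 * (expR (- c * m%:R)) ^+ 2.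
  apply: le_trans (lerXn2r j _ _ half) _; rewrite ?nnegrE ?expR_ge0//.
  rewrite -!expRM_natl -expRD ler_expR.
  have hm : (m <= 4 * n * (j + 2))%N.
    have := ltn_pmod (2 * m) (_ : 0 < 8 * n)%N.
    have := divn_eq (2 * m) (8 * n).
    rewrite /j; set q := (_ %/ _)%N; set r := (_ %% _)%N => e /(_ ltac:(lia)) hr.
    have : (q <= q.-1 + 1)%N by lia.
    move: (q.-1) => q'; nia.
  have hmR : m%:R <= 4 * n%:R * (j%:R + 2) :> R.
    by rewrite -!natrM -natrD -natrM ler_nat.
  have : c * m%:R <= 4^-1 * (j%:R + 2).
    rewrite /c mulrC ler_pdivrMr ?mulr_gt0//; lra.
  lra.
(* Cube of $2m+1\le(1+6/c)(1+cm/3)$, where $1+cm/3\le e^{cm/3}$; the 6 is chosen so that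
   $(6/c)(cm/3)=2m$. *)
have hp : (2 * m).+1%:R ^+ 3 <= (1 + 6 / c) ^+ 3 * expR (c * m%:R) :> R.
  have -> : c * m%:R = 3%:R * (c * m%:R / 3) by field.
  rewrite expRM_natl -exprMn lerXn2r ?nnegrE ?mulr_ge0 ?expR_ge0//.
    by rewrite addr_ge0// divr_ge0// ltW.
  apply: le_trans (ler_wpM2l _ (expR_ge1Dx _)); last by rewrite addr_ge0// divr_ge0// ltW.
  have -> : (1 + 6 / c) * (1 + c * m%:R / 3) = 1 + 2 * m%:R + c * m%:R / 3 + 6 / c.
    by field; lra.
  rewrite -addn1 natrD natrM.
  have : 0 <= c * m%:R / 3 by rewrite divr_ge0// mulr_ge0// ltW.
  have : 0 <= 6 / c by rewrite divr_ge0// ltW.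
  lra.
apply: le_trans (ler_pM _ _ hp hj) _; rewrite ?exprn_ge0//.
rewrite mulNr expRN expr2.
rewrite le_eqVlt; apply/orP; left; apply/eqP; field.
by rewrite expR_eq0 gt_eqF.
Qed.

Theorem theorem1p2 (R : realType) :
  (exists alpha : R, 0 < alpha < 1 /\
     forall p : simplex R,
       (exists n : nat, (1 < n)%N /\
          (coloring_law p (crossing n) < alpha%:E)%E) ->
       compact_phase p) /\
  (forall p : simplex R, compact_phase p \/ extended_phase p).
Proof.
(* This is 1/1458, for which each step of the recursion halves the bound. *)
pose a : R := 729%:R^-1 / 2.
have a0 : 0 < a by rewrite divr_gt0// invr_gt0 ltr0n.
have aE : 729%:R * a = 2^-1 by rewrite mulrA divff ?mul1r// pnatr_eq0.
have a1 : a < 1.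
  have : 1 * a <= 729%:R * a by rewrite ler_wpM2r ?(ltW a0)// ler1n.
  by rewrite aE mul1r => /le_lt_trans; apply; rewrite invf_lt1// ltr1n.
split.
  exists a; split; first by rewrite a0.
  by move=> p [n [n1]]; apply: compact_of_small_crossing (ltW a0) aE; lia.
move=> p; have [|ncomp] := pselect (compact_phase p); first by left.
right; exists a; split => // n n0; rewrite leNgt; apply/negP => small.
(* The criterion also covers [n = 1], so outside the compact phase [a] is a lower bound for every
   positive [n]. *)
by apply: ncomp; exact: compact_of_small_crossing n0 (ltW a0) aE small.
Qed.
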